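(* Let $X$ be a locally compact and $\sigma$-compact space and let $\mathcal{A}=((a_{N,n})_{N\in\mathbb{N}})_{n\in\mathbb{N}}$ be a double sequence of weights on $X$ with $a_{N,n+1}\le a_{N,n}\le a_{N+1,n}$ for all $N,n$. The following conditions are equivalent: (i) $\mathcal{A}$ satisfies (wQ), that is, $\forall N\,\exists M,n\,\forall K,m\,\exists k,S>0:\ \frac1{a_{M,m}}\le\max\big(\frac{S}{a_{N,n}},\frac{S}{a_{K,k}}\big)$, and the spectrum $\mathcal{A}C$ satisfies $\forall N\,\exists M\,\forall m\,\exists n:\ B_{M,m}\subseteq\bigcap_{k\in\mathbb{N}}\big((B_{N,n}\cap AC(X))+\frac1kB_{N,n}\big)$. (ii) $\mathcal{A}$ satisfies (Q), that is, $\forall N\,\exists M,n\,\forall K,m,\epsilon>0\,\exists k,S>0:\ \frac1{a_{M,m}}\le\max\big(\frac{\epsilon}{a_{N,n}},\frac{S}{a_{K,k}}\big)$.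
   Context: Topological spaces are Hausdorff; indices range over $\mathbb{N}$; inequalities between functions are pointwise on $X$. A weight is a strictly positive continuous function on $X$. $C(X)$ is the space of continuous scalar functions on $X$; for a weight $a$, $Ca(X)=\{f\in C(X):\|f\|_a=\sup_{x\in X}a(x)|f(x)|<\infty\}$, a Banach space. $B_{N,n}$ is the closed unit ball of $Ca_{N,n}(X)$. $\mathcal{A}_NC(X)=\operatorname{ind}_nCa_{N,n}(X)$ (union over $n$ with the locally convex inductive limit topology); $\mathcal{A}C=(\mathcal{A}_NC(X))_N$ is the projective spectrum with inclusions as linking maps, and $AC(X)=\operatorname{proj}_N\mathcal{A}_NC(X)=\bigcap_N\mathcal{A}_NC(X)$. Standing normalization: every bounded subset of $\mathcal{A}_NC(X)$ is contained in $B_{N,n}$ for some $n$. *)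

(* Defs.v *)
From HB Require Import structures.
From mathcomp Require Import all_boot all_order all_algebra.
From mathcomp Require Import all_classical all_reals all_analysis.
From mathcomp Require Import complex.

Set Implicit Arguments.
Unset Strict Implicit.
Unset Printing Implicit Defensive.

Import Order.TTheory GRing.Theory Num.Theory.
Import numFieldNormedType.Exports.

Local Open Scope classical_set_scope.
Local Open Scope ring_scope.

(* The scalar field K is the field of real or of complex numbers. The norm of
   R[i] takes its values in R[i], so the R-valued absolute value is a separate
   parameter abs. *)
Inductive scalar_field (R : realType) : forall K : numFieldType, (K -> R) -> Prop :=
| real_scalars : @scalar_field R R (fun z => `|z|)
| complex_scalars : @scalar_field R R[i] (@ComplexField.Normc.normc R).

Definition sigma_compact_space (X : topologicalType) : Prop :=
  exists2 F : nat -> set X, (forall i, compact (F i)) & \bigcup_i F i = setT.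

Definition is_weight (R : realType) (X : topologicalType) (a : X -> R) : Prop :=
  continuous a /\ forall x, 0 < a x.

(* a N n stands for a_{N,n}. *)
Definition weight_system (R : realType) (X : topologicalType)
    (a : nat -> nat -> X -> R) : Prop :=
  (forall N n, is_weight (a N n)) /\
  (forall N n x, a N n.+1 x <= a N n x <= a N.+1 n x).

(* -oo when X is empty: harmless, as only upper bounds on it are ever used. *)
Definition wnorm (R : realType) (X : topologicalType) (K : numFieldType)
    (abs : K -> R) (a : X -> R) (f : X -> K) : \bar R :=
  ereal_sup (range (fun x => (a x * abs (f x))%:E)).

Definition Ca (R : realType) (X : topologicalType) (K : numFieldType)
    (abs : K -> R) (a : X -> R) : set (X -> K) :=
  [set f | continuous f /\ (wnorm abs a f < +oo)%E].

Definition Ca_ball (R : realType) (X : topologicalType) (K : numFieldType)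
    (abs : K -> R) (a : X -> R) : set (X -> K) :=
  [set f | Ca abs a f /\ (wnorm abs a f <= 1)%E].

(* Underlying set of ind_n Ca_n(X) for a decreasing sequence of weights a_n;
   its topology is given by ind_nbhs0 below. *)
Definition ind_C (R : realType) (X : topologicalType) (K : numFieldType)
    (abs : K -> R) (a : nat -> X -> R) : set (X -> K) :=
  \bigcup_n Ca abs (a n).

Definition proj_C (R : realType) (X : topologicalType) (K : numFieldType)
    (abs : K -> R) (a : nat -> nat -> X -> R) : set (X -> K) :=
  \bigcap_N ind_C abs (a N).

Definition fscale (T : Type) (K : numFieldType) (c : K) (A : set (T -> K)) :
    set (T -> K) :=
  [set c \*o f | f in A].

Definition fsum (T : Type) (K : numFieldType) (A B : set (T -> K)) :
    set (T -> K) :=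
  [set f \+ g | f in A & g in B].

Definition absolutely_convex (T : Type) (K : numFieldType) (V : set (T -> K)) :
    Prop :=
  forall (f g : T -> K) (c d : K),
    V f -> V g -> `|c| + `|d| <= 1 -> V ((c \*o f) \+ (d \*o g)).

Definition Ca_nbhs0 (R : realType) (X : topologicalType) (K : numFieldType)
    (abs : K -> R) (a : X -> R) (U : set (X -> K)) : Prop :=
  exists2 e : R, 0 < e &
    [set f | Ca abs a f /\ (wnorm abs a f < e%:E)%E] `<=` U.

(* The neighbourhoods of 0 in the locally convex inductive limit topology, the
   finest locally convex topology making all inclusions of the steps
   continuous: a base is given by the absolutely convex subsets of the union
   whose trace on every step is a neighbourhood of 0. *)
Definition ind_nbhs0 (R : realType) (X : topologicalType) (K : numFieldType)
    (abs : K -> R) (a : nat -> X -> R) (U : set (X -> K)) : Prop :=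
  exists2 V : set (X -> K), V `<=` U &
    [/\ V `<=` ind_C abs a, absolutely_convex V
      & forall n, Ca_nbhs0 abs (a n) V].

Definition ind_bounded (R : realType) (X : topologicalType) (K : numFieldType)
    (abs : K -> R) (a : nat -> X -> R) (B : set (X -> K)) : Prop :=
  B `<=` ind_C abs a /\
  forall U : set (X -> K), ind_nbhs0 abs a U ->
    exists2 c : K, 0 < c & B `<=` fscale c U.

Definition normalized (R : realType) (X : topologicalType) (K : numFieldType)
    (abs : K -> R) (a : nat -> nat -> X -> R) : Prop :=
  forall (N : nat) (B : set (X -> K)), ind_bounded abs (a N) B ->
    exists n, B `<=` Ca_ball abs (a N n).

Definition condQ (R : realType) (X : topologicalType)
    (a : nat -> nat -> X -> R) : Prop :=
  forall N : nat, exists M n : nat, forall (K m : nat) (eps : R), 0 < eps ->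
    exists (k : nat) (S : R), 0 < S /\
      forall x, 1 / a M m x <= Num.max (eps / a N n x) (S / a K k x).

Definition condwQ (R : realType) (X : topologicalType)
    (a : nat -> nat -> X -> R) : Prop :=
  forall N : nat, exists M n : nat, forall K m : nat,
    exists (k : nat) (S : R), 0 < S /\
      forall x, 1 / a M m x <= Num.max (S / a N n x) (S / a K k x).

Definition spectrum_cond (R : realType) (X : topologicalType)
    (K : numFieldType) (abs : K -> R) (a : nat -> nat -> X -> R) : Prop :=
  forall N : nat, exists M : nat, forall m : nat, exists n : nat,
    Ca_ball abs (a M m) `<=`
      \bigcap_(k in [set k | (0 < k)%N])
        fsum (Ca_ball abs (a N n) `&` proj_C abs a)
             (fscale (1 / k%:R) (Ca_ball abs (a N n))).

(* Main.v *)
Require Import Defs.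
From mathcomp Require Import all_boot all_order all_algebra.
From mathcomp Require Import all_classical all_reals all_analysis.
From mathcomp Require Import complex lra.

(** Write [v_{N,n} = 1 / a_{N,n}], so that membership of [f] in a multiple of
    the unit ball of the step [(N,n)] reads [|f| <= C v_{N,n}]; the [v_{N,n}]
    increase with [n] and decrease with [N].

    (Q) implies (wQ) by taking [eps = 1].  It implies the density condition on
    the spectrum by truncation: given [|f| <= v_{M,m}] and [eps > 0], let [h] be
    the radial truncation of [f] to modulus at most [eps v_{N,n}].  Where
    [f - h] does not vanish, [|f| > eps v_{N,n}], so the first alternative in
    the maximum of (Q) fails and [|f - h| <= |f| <= v_{M,m} <= S v_{K,k}] there.
    This holds for every [K], hence [f - h] belongs to [AC(X)].

    Conversely, the density condition applied to the function [v_{M,m}] itself,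
    which lies in the ball [B_{M,m}], gives (Q) except that [n] may depend on
    [m] ([spectrum_cond_weights]).  Condition (wQ), applied to [M] in place of
    [N], removes that dependence: it yields [M'] and one fixed [p] such that
    every [v_{M',m}] is bounded by a multiple of the maximum of [v_{M,p}] and
    some [v_{K,k}].  The weakened (Q) is then only needed for [m = p].

    Real and complex scalars are treated together through the embedding of the
    reals into the scalar field ([scalar_embedding]). *)

Set Implicit Arguments.
Unset Strict Implicit.
Unset Printing Implicit Defensive.

Import Order.TTheory GRing.Theory Num.Theory.
Import numFieldNormedType.Exports.

Local Open Scope classical_set_scope.
Local Open Scope ring_scope.

(** * Scalars *)

(** The order of the scalar field restricts to that of the reals, and its norm
    factors through them: all that the proof uses of real or complex scalars
    follows from these two facts. *)
Lemma scalar_embedding (R : realType) (K : numFieldType) (abs : K -> R) :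
  scalar_field abs ->
  exists iota : {rmorphism R -> K},
    (forall z, `|z| = iota (abs z)) /\ {mono iota : x y / x <= y}.
Proof.
case: K abs / => [|].
  by exists idfun.
exists (real_complex R); split => [[x y] //|x y].
by rewrite lecR.
Qed.

Section EmbeddedReals.
Context (R : realType) (K : numFieldType) (abs : K -> R).
Context (iota : {rmorphism R -> K}).
Hypothesis normE : forall z, `|z| = iota (abs z).
Hypothesis iota_le : {mono iota : x y / x <= y}.

Lemma iota_norm (r : R) : `|iota r| = iota `|r|.
Proof.
have [r0|/ltW r0] := lerP 0 r.
  by rewrite (ger0_norm r0) ger0_norm// -(rmorph0 iota) iota_le.
by rewrite (ler0_norm r0) ler0_norm ?rmorphN// -(rmorph0 iota) iota_le.
Qed.

Lemma abs_iota (r : R) : abs (iota r) = `|r|.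
Proof. by apply: (inc_inj iota_le); rewrite -normE iota_norm. Qed.

Lemma abs_ge0 (z : K) : 0 <= abs z.
Proof. by rewrite -iota_le rmorph0 -normE. Qed.

Lemma absM (y z : K) : abs (y * z) = abs y * abs z.
Proof. by apply: (inc_inj iota_le); rewrite rmorphM -!normE normrM. Qed.

Lemma abs_triangle (y z : K) : abs (y + z) <= abs y + abs z.
Proof. by rewrite -iota_le rmorphD -!normE ler_normD. Qed.

Lemma abs_inv_nat (k : nat) : abs (1 / k%:R) = k%:R^-1.
Proof.
by rewrite -(rmorph_nat iota) div1r -fmorphV abs_iota ger0_norm.
Qed.

Lemma positive_scalarE (e : K) : 0 < e -> exists2 r : R, 0 < r & e = iota r.
Proof.
move=> e0; exists (abs e); last by rewrite -normE gtr0_norm.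
by rewrite -(leW_mono iota_le) rmorph0 -normE gtr0_norm.
Qed.

Lemma continuous_iota : continuous iota.
Proof.
move=> x; apply/cvgrPdist_lt => _ /positive_scalarE[r r0 ->].
near=> y.
rewrite -rmorphB iota_norm (leW_mono iota_le).
by near: y; apply: cvgr_dist_lt.
Unshelve. all: by end_near. Qed.

Lemma continuous_abs : continuous abs.
Proof.
move=> z; apply/(@cvgrPdist_lt _ R _ (nbhs z) _) => r r0.
near=> y.
rewrite -(leW_mono iota_le) -iota_norm rmorphB -!normE.
apply: le_lt_trans (ler_dist_dist _ _) _.
near: y; apply: cvgr_dist_lt => //.
by rewrite -(rmorph0 iota) (leW_mono iota_le).
Unshelve. all: by end_near. Qed.

End EmbeddedReals.

(** * Weighted spaces *)

Section WeightedSpaces.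
Context (R : realType) (K : numFieldType) (abs : K -> R).
Context (X : topologicalType).

Lemma wnorm_leP (a : X -> R) (f : X -> K) (c : R) :
  (wnorm abs a f <= c%:E)%E <-> forall x, a x * abs (f x) <= c.
Proof.
split=> [fc x|fc].
  by rewrite -lee_fin; apply: le_trans fc; apply: ereal_sup_ubound; exists x.
by apply: ub_ereal_sup => _ [x _ <-]; rewrite lee_fin.
Qed.

Lemma CaP (a : X -> R) (f : X -> K) : (forall x, 0 < a x) ->
  Ca abs a f <->
  continuous f /\ exists2 C, 0 < C & forall x, abs (f x) <= C / a x.
Proof.
move=> a0; split=> [[cf foo]|[cf [C C0 fC]]]; split=> //.
  have [c fc] : exists c : R, (wnorm abs a f <= c%:E)%E.
    case: (wnorm abs a f) foo => [r||]// _; first by exists r.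
    by exists 0; rewrite leNye.
  exists (Num.max c 1) => [|x]; first by rewrite lt_max ltr01 orbT.
  rewrite ler_pdivlMr// mulrC le_max.
  by move/wnorm_leP: fc => ->.
apply: (@le_lt_trans _ _ C%:E); last exact: ltry.
by apply/wnorm_leP => x; rewrite mulrC -ler_pdivlMr.
Qed.

Lemma Ca_ballP (a : X -> R) (f : X -> K) : (forall x, 0 < a x) ->
  Ca_ball abs a f <-> continuous f /\ forall x, abs (f x) <= 1 / a x.
Proof.
move=> a0; split=> [[[cf _] /wnorm_leP f1]|[cf f1]].
  by split=> // x; rewrite ler_pdivlMr// mulrC.
split; first by apply/CaP => //; split=> //; exists 1.
by apply/wnorm_leP => x; rewrite mulrC -ler_pdivlMr.
Qed.

Lemma inv_weight_le (a : nat -> nat -> X -> R) (N M m n : nat) (x : X) :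
  weight_system a -> (N <= M)%N -> (m <= n)%N -> 1 / a M m x <= 1 / a N n x.
Proof.
move=> [wa mono_a] NM mn.
have a0 i j : 0 < a i j x by case: (wa i j).
rewrite !div1r lef_pV2 ?posrE//; apply: (@le_trans _ _ (a M n x)).
  apply: (@homo_leq _ (fun i => a i n x) <=%O) => //; first exact: le_trans.
  by move=> i; case/andP: (mono_a i n x).
apply: (@homo_leq _ (fun j => a M j x) (fun u v => v <= u)) => //.
  by move=> u v w uv vw; apply: le_trans vw uv.
by move=> j; case/andP: (mono_a M j x).
Qed.

End WeightedSpaces.

(** * From (Q) to the density condition *)

Lemma condQ_condwQ (R : realType) (X : topologicalType)
    (a : nat -> nat -> X -> R) :
  weight_system a -> condQ a -> condwQ a.
Proof.
move=> [wa _] Qa N; have [M [n QN]] := Qa N; exists M, n => L m.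
have [k [S [S0 QS]]] := QN L m 1 ltr01.
exists k, (Num.max 1 S); split=> [|x]; first by rewrite lt_max ltr01.
have a0 i j : 0 < a i j x by case: (wa i j).
apply: le_trans (QS x) _; rewrite ge_max !le_max.
by rewrite !ler_pM2r ?invr_gt0 ?a0 // !le_max !lexx /= !orbT.
Qed.

(** The radial truncation [h] of [f] to modulus at most [w] is written
    [f * w / max (|f|, w)]: the denominator is positive even where [f] vanishes,
    so [h] is continuous. *)
Lemma continuous_truncation (R : realType) (K : numFieldType) (abs : K -> R)
    (X : topologicalType) (f : X -> K) (w : X -> R) :
  scalar_field abs -> continuous f -> continuous w -> (forall x, 0 < w x) ->
  exists g h : X -> K, [/\ continuous g, continuous h, f = g \+ h,
    (forall x, abs (h x) <= w x) &
    forall x, abs (g x) <= abs (f x) /\ (abs (f x) <= w x -> abs (g x) = 0)].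
Proof.
move=> /scalar_embedding[iota [normE iota_le]] cf cw w0.
pose d x := Num.max (abs (f x)) (w x).
have d0 x : 0 < d x by rewrite lt_max w0 orbT.
pose t x := w x / d x.
have t0 x : 0 <= t x by rewrite divr_ge0// ltW.
have t1 x : t x <= 1 by rewrite ler_pdivrMr// mul1r le_max lexx orbT.
have ct : continuous t.
  move=> x; apply: cvgM; first exact: cw.
  apply: cvgV; first by rewrite gt_eqF.
  apply: continuous_max; last exact: cw.
  apply: continuous_comp; first exact: cf.
  exact: continuous_abs.
have ch : continuous (fun x => f x * iota (t x)).
  move=> x; apply: cvgM; first exact: cf.
  by apply: continuous_comp; [exact: ct|exact: continuous_iota].
exists (fun x => f x - f x * iota (t x)), (fun x => f x * iota (t x)).
split=> //.
- by move=> x; apply: cvgB; [exact: cf|exact: ch].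
- by apply/funext => x /=; rewrite subrK.
- move=> x; rewrite (absM normE iota_le) (abs_iota normE iota_le) ger0_norm//.
  rewrite /t mulrA ler_pdivrMr// mulrC ler_pM2l//.
  by rewrite le_max lexx.
move=> x; have -> : f x - f x * iota (t x) = f x * iota (1 - t x).
  by rewrite rmorphB rmorph1 mulrBr mulr1.
rewrite (absM normE iota_le) (abs_iota normE iota_le) ger0_norm ?subr_ge0//.
split; first by rewrite ler_piMr ?gerBl// (abs_ge0 normE iota_le).
by move=> fw; rewrite /t /d max_r// divff ?gt_eqF// subrr mulr0.
Qed.

Lemma condQ_spectrum_cond (R : realType) (K : numFieldType) (abs : K -> R)
    (X : topologicalType) (a : nat -> nat -> X -> R) :
  scalar_field abs -> weight_system a -> condQ a -> spectrum_cond abs a.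
Proof.
move=> hK ha Qa N; have [iota [normE iota_le]] := scalar_embedding hK.
have a0 i j x : 0 < a i j x by case: ha => wa _; case: (wa i j).
have [M [n QN]] := Qa N.
(* The two maxima make the unit ball of the step with indices max(M,N), m lie
   in that of N, max(n,m), which therefore contains g as |g| <= |f|. *)
exists (maxn M N) => m; exists (maxn n m) => f /(Ca_ballP _ _ (a0 _ _))[cf f1].
have fM x : abs (f x) <= 1 / a M m x.
  by apply: le_trans (f1 x) (inv_weight_le _ ha _ _) => //; rewrite leq_maxl.
move=> k /= k0; have e0 : 0 < k%:R^-1 :> R by rewrite invr_gt0 ltr0n.
pose w x := k%:R^-1 / a N (maxn n m) x.
have w0 x : 0 < w x by rewrite divr_gt0.
have cw : continuous w.
  move=> x; apply: cvgM; first exact: cvg_cst.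
  apply: cvgV; first by rewrite gt_eqF.
  by case: ha => wa _; case: (wa N (maxn n m)) => ca _; exact: ca.
have [g [h [cg ch fgh hw gf]]] := continuous_truncation hK cf cw w0.
exists g; first split.
- apply/Ca_ballP => //; split=> // x; apply: le_trans (gf x).1 _.
  apply: le_trans (f1 x) (inv_weight_le _ ha _ _).
    by rewrite leq_maxr.
  by rewrite leq_maxr.
- move=> L _; have [l [S [S0 QS]]] := QN L m _ e0.
  exists l => //; apply/CaP => //; split=> //; exists S => // x.
  have [fw|wf] := leP (abs (f x)) (w x).
    by rewrite (gf x).2// divr_ge0// ltW.
  apply: le_trans (gf x).1 (le_trans (fM x) _).
  (* As |f x| > w x, the first term of the maximum in (Q) is too small. *)
  have := QS x; rewrite le_max => /orP[MN|//].
  suff : abs (f x) <= w x by rewrite leNgt wf.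
  apply: le_trans (fM x) (le_trans MN _).
  rewrite /w ler_pM2l// -[leLHS]div1r -[leRHS]div1r.
  by apply: inv_weight_le => //; rewrite leq_maxl.
exists h; last by rewrite fgh.
exists (fun x => k%:R * h x).
  apply/Ca_ballP => //; split=> [x|x].
    by apply: cvgM; [exact: cvg_cst|exact: ch].
  rewrite (absM normE iota_le) -(rmorph_nat iota) (abs_iota normE iota_le).
  rewrite ger0_norm// mulrC -ler_pdivlMr ?ltr0n//.
  by apply: le_trans (hw x) _; rewrite /w div1r mulrC.
by apply/funext => x /=; rewrite mulrA divfK ?mul1r// pnatr_eq0 -lt0n.
Qed.

(** * From the density condition to (Q) *)

(** Approximating the function [1 / a_{M,m}] itself yields (Q) with [n]
    depending on [m]; the factors 2 below turn a sum of two terms into a maximum. *)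
Lemma spectrum_cond_weights (R : realType) (K : numFieldType) (abs : K -> R)
    (X : topologicalType) (a : nat -> nat -> X -> R) :
  scalar_field abs -> weight_system a -> spectrum_cond abs a ->
  forall N, exists M, forall m, exists n, forall (L : nat) (eps : R), 0 < eps ->
    exists (k : nat) (S : R), 0 < S /\
      forall x, 1 / a M m x <= Num.max (eps / a N n x) (S / a L k x).
Proof.
move=> /scalar_embedding[iota [normE iota_le]] [wa _] sc N.
have a0 i j x : 0 < a i j x by case: (wa i j).
have [M sM] := sc N; exists M => m; have [n sMm] := sM m.
exists n => L eps eps0.
have vball : Ca_ball abs (a M m) (fun x => iota (1 / a M m x)).
  apply/Ca_ballP => //; split=> x.
    apply: (@continuous_comp _ _ _ (fun x => 1 / a M m x)); last first.
      exact: continuous_iota.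
    apply: cvgM; first exact: cvg_cst.
    apply: cvgV; first by rewrite gt_eqF.
    by case: (wa M m) => ca _; exact: ca.
  by rewrite (abs_iota normE iota_le) ger0_norm// divr_ge0// ltW.
pose k := (Num.truncn (2 / eps)).+1.
have keps : k%:R^-1 * 2 <= eps.
  rewrite mulrC ler_pdivrMr ?ltr0n// -ler_pdivrMl// mulrC.
  by apply/ltW; rewrite truncnS_gt.
have [g [_ gAC] [_ [h /(Ca_ballP _ _ (a0 _ _))[_ h1] <-] vE]] :=
  sMm _ vball k isT.
have [l _ /(CaP _ _ (a0 _ _))[_ [S S0 gS]]] := gAC L I.
exists l, (S * 2); split=> [|x]; first exact: mulr_gt0.
have : 1 / a M m x <= S / a L l x + k%:R^-1 * (1 / a N n x).
  have v0 : 0 <= 1 / a M m x by rewrite divr_ge0// ltW.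
  rewrite -[leLHS]ger0_norm// -(abs_iota normE iota_le).
  have -> : iota (1 / a M m x) = g x + 1 / k%:R * h x.
    exact: esym (congr1 (@^~ x) vE).
  apply: le_trans (abs_triangle normE iota_le _ _) (lerD (gS x) _).
  rewrite (absM normE iota_le) (abs_inv_nat normE iota_le).
  by rewrite ler_pM2l// invr_gt0 ltr0n.
rewrite le_max => Mlt; apply/orP.
have kN : k%:R^-1 * 2 * (1 / a N n x) <= eps / a N n x.
  by rewrite div1r ler_pM2r ?invr_gt0.
have [gh|hg] := leP (S / a L l x) (k%:R^-1 * (1 / a N n x)); [left|right].
  apply: le_trans kN; lra.
rewrite mulrAC; lra.
Qed.

(** Substituting the bound of [spectrum_cond_weights] for the first term of the
    maximum in (wQ). *)
Lemma condwQ_spectrum_cond_condQ (R : realType) (K : numFieldType)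
    (abs : K -> R) (X : topologicalType) (a : nat -> nat -> X -> R) :
  scalar_field abs -> weight_system a ->
  condwQ a -> spectrum_cond abs a -> condQ a.
Proof.
move=> hK ha wQa sc N.
have a0 i j x : 0 < a i j x by case: ha => wa _; case: (wa i j).
have [M1 sM1] := spectrum_cond_weights hK ha sc N.
have [M2 [n2 wQ2]] := wQa M1.
have [n sn] := sM1 n2.
exists M2, n => L m eps eps0.
have [k1 [S1 [S10 Q1]]] := wQ2 L m.
(* The constant S1 of (wQ) multiplies this bound, whence eps / S1. *)
have [k2 [S2 [S20 Q2]]] := sn L (eps / S1) (divr_gt0 eps0 S10).
exists (maxn k1 k2), (Num.max S1 (S1 * S2)).
split=> [|x]; first by rewrite lt_max S10.
have vL j S : (j <= maxn k1 k2)%N -> 0 <= S ->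
    S <= Num.max S1 (S1 * S2) ->
    S / a L j x <= Num.max S1 (S1 * S2) / a L (maxn k1 k2) x.
  move=> jk S0 Smax; apply: ler_pM => //; first by rewrite invr_ge0 ltW.
  rewrite -[leLHS]div1r -[leRHS]div1r.
  exact: inv_weight_le.
rewrite le_max; apply/orP.
have := Q1 x; rewrite le_max => /orP[QM1|QL]; last first.
  right; apply: le_trans QL (vL _ _ (leq_maxl _ _) (ltW S10) _).
  by rewrite le_max lexx.
have {}QM1 : 1 / a M2 m x <= S1 * (1 / a M1 n2 x).
  by rewrite [1 / a M1 n2 x]div1r.
have := Q2 x; rewrite le_max => /orP[QN|QL]; [left|right];
  apply: le_trans QM1 _.
  have -> : eps / a N n x = S1 * (eps / S1 / a N n x).
    by rewrite mulrA mulrCA divff ?mulr1// lt0r_neq0.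
  by rewrite ler_pM2l.
have QL1 : S1 * (1 / a M1 n2 x) <= S1 * S2 / a L k2 x.
  by rewrite -mulrA ler_pM2l.
apply: le_trans QL1 (vL _ _ (leq_maxr _ _) _ _).
  exact/ltW/mulr_gt0.
by rewrite le_max lexx orbT.
Qed.

Theorem proposition3p4 (R : realType) (K : numFieldType) (abs : K -> R)
    (hK : scalar_field abs)
    (X : topologicalType) (hX : hausdorff_space X)
    (lcX : locally_compact [set: X]%classic) (scX : sigma_compact_space X)
    (a : nat -> nat -> X -> R) (ha : weight_system a)
    (na : normalized abs a) :
  (condwQ a /\ spectrum_cond abs a) <-> condQ a.
Proof.
split=> [[wQa sc]|Qa]; first exact: condwQ_spectrum_cond_condQ hK ha wQa sc.
split; first exact: condQ_condwQ.
exact: condQ_spectrum_cond.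
Qed.
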